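(* Let $\Gamma$ be a finitely generated group and let $\mu$ be a finitely supported, nondegenerate probability measure on $\Gamma$. For every nonempty subset $A \subseteq \Gamma$ there is a $\mu$-stationary, finitely additive measure $M$ on $\Gamma$ such that $M(A) = 1$.
   Context: A probability measure $\mu$ on $\Gamma$ is nondegenerate if its support generates $\Gamma$ as a semigroup. A finitely additive measure on $\Gamma$ is a function $M \colon 2^\Gamma \to [0,\infty]$, defined on all subsets of $\Gamma$ and possibly taking the value $\infty$, such that $M(A \cup B) = M(A) + M(B)$ for all disjoint $A, B \subseteq \Gamma$. For $g \in \Gamma$, $gM$ is given by $[gM](E) = M(g^{-1}E)$. $M$ is $\mu$-stationary if $\mu * M = M$, where $\mu * M = \sum_{g \in \Gamma} \mu(g)\, gM$, i.e. $\sum_{g \in \operatorname{supp}\mu} \mu(g) M(g^{-1}E) = M(E)$ for every $E \subseteq \Gamma$. *)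

(* Defs.v *)
From HB Require Import structures.
From mathcomp Require Import all_boot all_order all_algebra.
From mathcomp Require Import all_classical all_reals all_analysis.

Set Implicit Arguments.
Unset Strict Implicit.
Unset Printing Implicit Defensive.

Import Order.TTheory GRing.Theory Num.Theory.
Local Open Scope classical_set_scope.
Local Open Scope ring_scope.

(* The carrier of G with every subset measurable, so that
   [probability (discrete G) R] is the type of probability measures on G
   defined on the full power set. *)
Definition discrete (G : groupType) : Type := G.

HB.instance Definition _ (G : groupType) := Choice.copy (discrete G) G.
HB.instance Definition _ (G : groupType) := isPointed.Build (discrete G) (1%g : G).
HB.instance Definition _ (G : groupType) :=
  @isMeasurable.Build default_measure_display (discrete G)
    discrete_measurable discrete_measurable0
    discrete_measurableC discrete_measurableU.

Definition gen_subgroup (G : groupType) (S : set G) : set G :=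
  smallest (fun H : set G => group_closed (mem H)) S.

Definition gen_semigroup (G : groupType) (S : set G) : set G :=
  smallest (fun H : set G => mulg_closed (mem H)) S.

Definition finitely_generated (G : groupType) : Prop :=
  exists S : set G, finite_set S /\ gen_subgroup S = [set: G].

(* The set of atoms, which is the support because the groups considered are
   countable (finitely generated). *)
Definition msupport (R : realType) (G : groupType)
    (mu : probability (discrete G) R) : set G :=
  [set g | mu [set g] != 0%E].

Definition finitely_supported (R : realType) (G : groupType)
    (mu : probability (discrete G) R) : Prop :=
  finite_set (msupport mu).

Definition nondegenerate_measure (R : realType) (G : groupType)
    (mu : probability (discrete G) R) : Prop :=
  gen_semigroup (msupport mu) = [set: G].

Definition finitely_additive_measure (R : realType) (G : groupType)
    (M : set G -> \bar R) : Prop :=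
  (forall E, (0 <= M E)%E) /\
  (forall A B, A `&` B = set0 -> M (A `|` B) = (M A + M B)%E).

Definition left_translate (R : realType) (G : groupType) (g : G)
    (M : set G -> \bar R) : set G -> \bar R :=
  fun E => M [set (g^-1 * x)%g | x in E].

(* Only meaningful when the support of mu is finite: a sum over an infinite
   family of nonzero terms in [\sum_(_ \in _)] is 0 by convention. *)
Definition convolution (R : realType) (G : groupType)
    (mu : probability (discrete G) R) (M : set G -> \bar R) :
    set G -> \bar R :=
  fun E => (\sum_(g \in msupport mu) mu [set g] * left_translate g M E)%E.

Definition stationary (R : realType) (G : groupType)
    (mu : probability (discrete G) R) (M : set G -> \bar R) : Prop :=
  convolution mu M = M.

(* Main.v *)
(* Write P f (x) = sum_g mu(g) f(g x) and let L be the space of bounded functions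
   supported in finitely many translates of A.  A stationary measure that is
   finite exactly on the sets whose indicator lies in L comes from a positive
   functional M on L with M(h - P h) = 0 and M(1_A) = 1.  By Hahn-Banach there is
   one as soon as (i) no h in L satisfies 1_A <= h - P h, and (ii) every f in L
   is bounded by c 1_A + h - P h for some c and some h in L.  Both use that the
   support generates G as a semigroup: (ii) because f(g x) <= mu(g)^-1 P f (x)
   for f >= 0, and (i) because the superharmonic function k = h - inf h >= 0
   satisfies a Harnack inequality k(x) >= p_g k(g x), while k >= 1 on A; thus
   k is bounded away from 0 wherever h does not vanish.  Where h vanishes,
   k = - inf h > 0 if inf h < 0, while if inf h >= 0 then h > 0 everywhere; so
   k is bounded away from 0, contradicting the definition of the infimum. *)
Require Import Defs.
From HB Require Import structures.
From mathcomp Require Import all_boot all_order all_algebra.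
From mathcomp Require Import all_classical all_reals all_analysis.
From mathcomp Require Import lra.

Local Open Scope classical_set_scope.

Import Order.TTheory GRing.Theory Num.Theory.
Local Open Scope ring_scope.

(** * Convex cones and a Hahn-Banach theorem *)

Definition convex_cone (R : realType) (V : lmodType R) (K : set V) : Prop :=
  [/\ K 0, forall f g, K f -> K g -> K (f + g)
    & forall c f, 0 <= c -> K f -> K (c *: f)].

(** Zorn's lemma: enlarging a maximal cone by any [v] outside it must capture [u], which is the last
    clause. *)
Lemma ex_maximal_cone (R : realType) (V : lmodType R) (K0 : set V) (u : V) :
  convex_cone R V K0 -> ~ K0 u ->
  exists K : set V, [/\ K0 `<=` K, convex_cone R V K, ~ K u
    & forall v, ~ K v -> exists k t, [/\ K k, 0 <= t & u = k + t *: v]].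
Proof.
move=> [K00 K0D K0Z] K0u.
(* Zorn runs over the sets [X] adjoined to [K0], so that the empty chain, whose union is empty,
   yields [K0] itself. *)
pose P (X : set V) := convex_cone R V (K0 `|` X) /\ ~ (K0 `|` X) u.
have [F FP totF|X [[[K_0 KD KZ] Ku] Xmax]] := @Zorn_bigcup V P.
  split; last by case=> // -[X FX Xu]; have [_] := FP _ FX; apply; right.
  split; first by left.
  - move=> f g [Kf|[X FX Xf]] [Kg|[Y FY Yg]].
    + by left; exact: K0D.
    + have [[_ + _] _] := FP _ FY.
      by move=> /(_ f g (or_introl Kf) (or_intror Yg))[|]; [left|right; exists Y].
    + have [[_ + _] _] := FP _ FX.
      by move=> /(_ f g (or_intror Xf) (or_introl Kg))[|]; [left|right; exists X].
    + have [Z [FZ Zf Zg]] : exists Z, [/\ F Z, Z f & Z g].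
        have [XY|YX] := totF _ _ FX FY.
          by exists Y; split => //; exact: XY.
        by exists X; split => //; exact: YX.
      have [[_ + _] _] := FP _ FZ.
      by move=> /(_ f g (or_intror Zf) (or_intror Zg))[|]; [left|right; exists Z].
  - move=> c f c0 [Kf|[X FX Xf]]; first by left; exact: K0Z.
    have [[_ _ +] _] := FP _ FX.
    by move=> /(_ c f c0 (or_intror Xf))[|]; [left|right; exists X].
exists (K0 `|` X); split => // v Kv.
apply: contrapT => nu.
pose Y := [set w | exists k t, [/\ (K0 `|` X) k, 0 <= t & w = k + t *: v]].
have KY : K0 `|` X `<=` Y.
  by move=> k Kk; exists k, 0; split => //; rewrite scale0r addr0.
have YE : K0 `|` Y = Y.
  by apply/seteqP; split => [w [K0w|//]|w]; [apply: KY; left|right].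
apply: (Xmax Y); last first.
  rewrite /P YE; split => //; split; first exact: KY.
  - move=> _ _ [k [t [Kk t0 ->]]] [k' [t' [Kk' t'0 ->]]].
    exists (k + k'), (t + t'); split; [exact: KD|exact: addr_ge0|].
    by rewrite scalerDl addrACA.
  - move=> c _ c0 [k [t [Kk t0 ->]]].
    exists (c *: k), (c * t); split; [exact: KZ|exact: mulr_ge0|].
    by rewrite scalerDr scalerA.
split; first by move=> w Xw; apply: KY; right.
move=> YX; apply: Kv; right; apply: YX.
by exists 0, 1; split => //; rewrite scale1r add0r.
Qed.

(* A Hahn-Banach theorem.  For a maximal cone [K] containing [K0] but not [u],
   the functional is [f |-> inf {c | f - c u \in K}]; maximality of [K] turns
   this sublinear functional into a linear one. *)
Lemma ex_cone_functional (R : realType) (V : lmodType R) (K0 L : set V) (u : V) :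
  convex_cone R V K0 -> K0 (- u) -> ~ K0 u ->
  L 0 -> L u -> (forall a f g, L f -> L g -> L (a *: f + g)) ->
  (forall f, L f -> exists c, K0 (f - c *: u)) ->
  exists M : V -> R,
    [/\ forall a f g, L f -> L g -> M (a *: f + g) = a * M f + M g,
        forall f, L f -> K0 f -> M f <= 0 & M u = 1].
Proof.
move=> cK0 K0Nu K0u L0 Lu Llin K0L.
have [K [K0K [K_0 KD KZ] Ku Kmax]] := ex_maximal_cone R V K0 u cK0 K0u.
have LN f : L f -> L (- f).
  by move=> Lf; rewrite -[- f]addr0 -scaleN1r; exact: Llin.
have LD f g : L f -> L g -> L (f + g).
  by move=> Lf Lg; rewrite -[f]scale1r; exact: Llin.
have LZ a f : L f -> L (a *: f).
  by move=> Lf; rewrite -[_ *: _]addr0; exact: Llin.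
(* For [c < 0], rescaling would put [u] in [K]. This bounds [D 0] below by 0, hence every [D f] from
   below. *)
have KNu c : K (- (c *: u)) -> 0 <= c.
  move=> Kc; rewrite leNgt; apply/negP => c0; apply: Ku.
  have /(KZ (- c)^-1 _) := Kc; rewrite -scaleNr scalerA mulVf; last first.
    by rewrite oppr_eq0 lt_eqF.
  by rewrite scale1r; apply; rewrite invr_ge0 oppr_ge0 ltW.
pose D (f : V) := [set c : R | K (f - c *: u)].
pose M (f : V) := inf (D f).
have DD f g c d : D f c -> D g d -> D (f + g) (c + d).
  by move=> fc gd; rewrite /D /= scalerDl opprD addrACA; exact: KD.
have D0 c : D 0 c -> 0 <= c by rewrite /D /= add0r; exact: KNu.
have Dinf f : L f -> has_inf (D f).
  move=> Lf; split; first by have [c /K0K] := K0L _ Lf; exists c.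
  have [d /K0K fd] := K0L _ (LN _ Lf); exists (- d) => c fc.
  by rewrite lerNl -subr_ge0 opprK addrC; apply: D0; rewrite -(subrr f); exact: DD.
have Mle f c : L f -> D f c -> M f <= c.
  by move=> Lf; apply: ge_inf; case: (Dinf _ Lf).
have Mapprox f e : L f -> 0 < e -> exists2 c, D f c & c < M f + e.
  by move=> Lf e0; exact: inf_adherent (Dinf _ Lf).
have MD_le f g : L f -> L g -> M (f + g) <= M f + M g.
  move=> Lf Lg; apply/ler_addgt0Pr => e e0.
  have e20 : 0 < e / 2 by rewrite divr_gt0.
  have [c fc cf] := Mapprox f _ Lf e20; have [d gd dg] := Mapprox g _ Lg e20.
  have := Mle _ _ (LD _ _ Lf Lg) (DD _ _ _ _ fc gd); lra.
have M0 : M 0 = 0.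
  apply/eqP; rewrite eq_le; apply/andP; split.
    by apply: Mle => //; rewrite /D /= scale0r subr0.
  by apply: lb_le_inf; [case: (Dinf _ L0)|move=> c; exact: D0].
have MN f : L f -> M (- f) = - M f.
  move=> Lf; apply/eqP; rewrite eq_le; apply/andP; split; last first.
    by have := MD_le _ _ Lf (LN _ Lf); rewrite subrr M0; lra.
  apply/ler_addgt0Pr => e e0.
  (* As [M f - e] lies below the infimum, maximality writes [u] as [k + t *: (f - (M f - e) *: u)].
     Dividing by [t] bounds [M (- f)] by [- M f + e - t^-1]. *)
  have nK : ~ K (f - (M f - e) *: u).
    by move=> /(Mle _ _ Lf); lra.
  have [k [t [Kk t0 uE]]] := Kmax _ nK.
  have {}t0 : 0 < t.
    by rewrite lt_def t0 andbT; apply/eqP => tE; apply: Ku; rewrite uE tE scale0r addr0.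
  have : D (- f) (- (M f - e) - t^-1).
    rewrite /D /=; have -> : - f - (- (M f - e) - t^-1) *: u = t^-1 *: k.
      rewrite -[k in RHS](addrK (t *: (f - (M f - e) *: u))) -uE.
      rewrite scalerBr scalerA mulVf ?gt_eqF// scale1r.
      by rewrite scalerBl scaleNr !opprB opprK addrC -addrA.
    by apply: KZ => //; rewrite invr_ge0 ltW.
  move=> /(Mle _ _ (LN _ Lf)); have : 0 < t^-1 by rewrite invr_gt0.
  by move: (t^-1) => s; lra.
have MD f g : L f -> L g -> M (f + g) = M f + M g.
  move=> Lf Lg; apply/eqP; rewrite eq_le MD_le//=.
  have := MD_le _ _ (LN _ Lf) (LN _ Lg).
  by rewrite -opprD !MN//; [lra|exact: LD].
have MZ_le c f : 0 < c -> L f -> M (c *: f) <= c * M f.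
  move=> c0 Lf; rewrite mulrC -ler_pdivrMr//; apply/ler_addgt0Pr => e e0.
  have [d fd df] := Mapprox f _ Lf e0.
  rewrite ler_pdivrMr// mulrC (le_trans _ (ler_wpM2l (ltW c0) (ltW df)))//.
  by apply: Mle; [exact: LZ|rewrite /D /= -scalerA -scalerBr; apply: KZ => //; exact: ltW].
have MZp c f : 0 < c -> L f -> M (c *: f) = c * M f.
  move=> c0 Lf; apply/eqP; rewrite eq_le MZ_le//=.
  rewrite mulrC -ler_pdivlMr// mulrC.
  have {1}-> : f = c^-1 *: (c *: f) by rewrite scalerA mulVf ?gt_eqF// scale1r.
  by rewrite MZ_le ?invr_gt0//; exact: LZ.
have MZ c f : L f -> M (c *: f) = c * M f.
  move=> Lf; have [c0|c0|->] := ltgtP c 0; last by rewrite scale0r mul0r.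
    rewrite -[c]opprK scaleNr MN; last exact: LZ.
    by rewrite MZp ?mulNr// oppr_gt0.
  exact: MZp.
exists M; split => [a f g Lf Lg|f Lf K0f|].
- by rewrite MD// ?MZ//; exact: LZ.
- by apply: Mle => //; rewrite /D /= scale0r subr0; exact: K0K.
- have : M u <= 1 by apply: Mle => //; rewrite /D /= scale1r subrr.
  have : M (- u) <= - 1.
    by apply: Mle; [exact: LN|rewrite /D /= scaleN1r opprK addNr].
  by rewrite MN//; lra.
Qed.

(** * Functions living on finitely many translates, and the Markov operator *)

Lemma gen_semigroup_ind {G : groupType} (S Q : set G) :
  gen_semigroup S = [set: G] -> S `<=` Q ->
  (forall g h, Q g -> Q h -> Q (g * h)%g) -> forall g, Q g.
Proof.
move=> ST SQ QM g; have : gen_semigroup S g by rewrite ST.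
apply: smallest_sub => // a b; rewrite !inE; exact: QM.
Qed.

(** The space [L]: bounded functions supported in the union of the translates [g^-1 A] for [g] in
    [t]. *)
Definition carried {R : realType} {G : groupType} (A : set G) (f : G -> R) : Prop :=
  exists (t : seq G) (C : R), forall x,
    `|f x| <= C /\ (f x != 0 -> exists2 g, g \in t & A (g * x)%g).

(** The operator [P]. It is dual to convolution, since the function sending [x] to [\1_E (g * x)] is
    the indicator of [g^-1 E]. *)
Definition markov {R : realType} {G : groupType} (s : seq G) (m : G -> R)
    (f : G -> R) : G -> R :=
  fun x => \sum_(g <- s) m g * f (g * x)%g.

Lemma carried0 {R : realType} {G : groupType} (A : set G) :
  carried A (0 : G -> R).
Proof. by exists [::], 0 => x; rewrite normr0 lexx eqxx. Qed.

Lemma carried_indic {R : realType} {G : groupType} (A B : set G) :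
  B `<=` A -> carried A (\1_B : G -> R).
Proof.
move=> BA; exists [:: 1%g], 1 => x; rewrite indicE; split.
  by case: (x \in B); rewrite ?normr1 ?normr0.
case: (boolP (x \in B)) => [|_ /eqP//]; rewrite inE => Bx _.
by exists 1%g; rewrite ?inE// mul1g; exact: BA.
Qed.

Lemma carried_lin {R : realType} {G : groupType} (A : set G) (a : R) (f g : G -> R) :
  carried A f -> carried A g -> carried A (a *: f + g).
Proof.
move=> [t [C fC]] [t' [C' gC']].
exists (t ++ t'), (`|a| * C + C') => x.
have [fx ft] := fC x; have [gx gt] := gC' x; split.
  by rewrite (le_trans (ler_normD _ _))// normrM lerD// ler_wpM2l.
move=> fg; have [f0|/ft[h ht Ah]] := eqVneq (f x) 0; last first.
  by exists h => //; rewrite mem_cat ht.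
have [g0|/gt[h ht Ah]] := eqVneq (g x) 0; last first.
  by exists h => //; rewrite mem_cat ht orbT.
by move: fg; rewrite !fctE f0 g0 /= scaler0 addr0 eqxx.
Qed.

Lemma carried_translate {R : realType} {G : groupType} (A : set G) (g : G)
    (f : G -> R) :
  carried A f -> carried A (fun x => f (g * x)%g).
Proof.
move=> [t [C fC]]; exists [seq (h * g)%g | h <- t], C => x.
have [fx ft] := fC (g * x)%g; split => // /ft[h ht Ah].
by exists (h * g)%g; [exact: map_f|rewrite -mulgA].
Qed.

Lemma carried_scale {R : realType} {G : groupType} (A : set G) (a : R) (f : G -> R) :
  carried A f -> carried A (a *: f).
Proof. by move=> Af; rewrite -[_ *: _]addr0; apply: carried_lin => //; exact: carried0. Qed.

Lemma carried_markov {R : realType} {G : groupType} (A : set G) (s : seq G)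
    (m : G -> R) (f : G -> R) :
  carried A f -> carried A (markov s m f).
Proof.
move=> Af; elim: s => [|g s IHs].
  have -> : markov [::] m f = 0 by apply/funext => x; rewrite /markov big_nil.
  exact: carried0.
have -> : markov (g :: s) m f = m g *: (fun x => f (g * x)%g) + markov s m f.
  by apply/funext => x; rewrite /markov big_cons.
by apply: carried_lin => //; exact: carried_translate.
Qed.

Lemma markov_lin {R : realType} {G : groupType} (s : seq G) (m : G -> R)
    (a : R) (f g : G -> R) :
  markov s m (a *: f + g) = a *: markov s m f + markov s m g.
Proof.
apply/funext => x; rewrite /markov !fctE scaler_sumr -big_split/=.
by apply: eq_bigr => h _; rewrite mulrDr /GRing.scale/= mulrCA.
Qed.

Lemma markov0 {R : realType} {G : groupType} (s : seq G) (m : G -> R) :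
  markov s m 0 = 0.
Proof. by apply/funext => x; rewrite /markov big1// => g _; rewrite mulr0. Qed.

Lemma markov_scale {R : realType} {G : groupType} (s : seq G) (m : G -> R)
    (a : R) (f : G -> R) :
  markov s m (a *: f) = a *: markov s m f.
Proof. by rewrite -[a *: f]addr0 markov_lin markov0 addr0. Qed.

Lemma markov_ge {R : realType} {G : groupType} (s : seq G) (m : G -> R) (f : G -> R)
    (g x : G) :
  {in s, forall h, 0 < m h} -> (forall y, 0 <= f y) -> g \in s ->
  m g * f (g * x)%g <= markov s m f x.
Proof.
move=> m0 f0 gs; rewrite /markov (big_rem g)//= lerDl big_seq sumr_ge0// => h hs.
by rewrite mulr_ge0// ltW// m0// (mem_rem hs).
Qed.

(** * Harnack inequality and point (i) *)

(** For a generator, a single term of [P f] gives the bound; the constants multiply along products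
    and stay uniform in [x]. *)
Lemma harnack {R : realType} {G : groupType} (s : seq G) (m : G -> R) (f : G -> R) :
  {in s, forall g, 0 < m g} -> gen_semigroup [set` s] = [set: G] ->
  (forall x, 0 <= f x) -> (forall x, markov s m f x <= f x) ->
  forall g, exists2 p, 0 < p & forall x, p * f (g * x)%g <= f x.
Proof.
move=> m0 sT f0 Pf; apply: (gen_semigroup_ind _ _ sT) => [g /= gs|g h].
  by exists (m g) => [|x]; [exact: m0|exact: le_trans (markov_ge _ _ _ _ _ m0 f0 gs) _].
move=> [p p0 pf] [q q0 qf]; exists (q * p) => [|x]; first exact: mulr_gt0.
by rewrite (le_trans _ (qf x))// -mulrA ler_wpM2l ?(ltW q0)// -mulgA.
Qed.

Lemma carried_potential_false {R : realType} {G : groupType} (s : seq G) (m : G -> R)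
    (A : set G) (h : G -> R) :
  {in s, forall g, 0 < m g} -> \sum_(g <- s) m g = 1 ->
  gen_semigroup [set` s] = [set: G] -> A !=set0 -> carried A h ->
  ~ forall x, (\1_A x : R) <= h x - markov s m h x.
Proof.
move=> m0 m1 sT [a Aa] [t [C hC]] hP.
have hinf : has_inf (range h).
  split; first by exists (h 1%g), 1%g.
  by exists (- C) => _ [x _ <-]; have [] := hC x; rewrite ler_norml => /andP[].
pose i := inf (range h); pose k x := h x - i.
have k0 x : 0 <= k x.
  by rewrite subr_ge0; apply: ge_inf; [case: hinf|exists x].
(* Total mass 1 means that [P] fixes constants. *)
have Pk x : markov s m k x = markov s m h x - i.
  rewrite /markov /k -[i in RHS]mul1r -m1 mulr_suml -sumrB.
  by apply: eq_bigr => g _; rewrite mulrBr.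
have Ik x : \1_A x <= k x - markov s m k x by rewrite Pk; have := hP x; rewrite /k; lra.
have I0 x : 0 <= \1_A x :> R by rewrite indicE.
have Pk_le x : markov s m k x <= k x by have := Ik x; have := I0 x; lra.
have kA x : A x -> 1 <= k x.
  move=> Ax; have := Ik x; rewrite indicE mem_set//=.
  have : 0 <= markov s m k x.
    by rewrite /markov big_seq sumr_ge0// => g gs; rewrite mulr_ge0// ltW// m0.
  lra.
have H := harnack s m k m0 sT k0 Pk_le.
(* [d] is the minimum of 1 and the Harnack constants of the finitely many [g] in [t]. *)
have [d d0 dk] : exists2 d, 0 < d &
    forall x, (exists2 g, g \in t & A (g * x)%g) -> d <= k x.
  elim: (t) => [|g t' [d d0 IH]]; first by exists 1 => // x [].
  have [p p0 pk] := H g; exists (Num.min d p); first by rewrite lt_min d0.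
  move=> x [b]; rewrite inE => /orP[/eqP-> Ax|bt' Ax]; rewrite ge_min; apply/orP.
    by right; rewrite (le_trans _ (pk x))// ler_peMr ?(ltW p0)// kA.
  by left; apply: IH; exists b.
(* Since [a = (a * x^-1) * x], Harnack compares [k x] with [k a], which is at least 1. *)
have kpos x : 0 < k x.
  have [p p0 /(_ x)] := H (a * x^-1)%g; rewrite mulgVK.
  by apply: lt_le_trans; rewrite mulr_gt0// (lt_le_trans _ (kA _ Aa)).
have kd x : h x != 0 -> d <= k x by move=> /(proj2 (hC x)); exact: dk.
(* A point nearly attaining the infimum has small [k]. If [i < 0], then [k] is at least [d] where
   [h] is nonzero and equals [- i] elsewhere; otherwise [h > i] makes [h] nonzero everywhere. *)
have [i0|i0] := ltP i 0.
  have [_ [x _ <-]] : exists2 e, range h e & e < i + Num.min d (- i).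
    by apply: inf_adherent => //; rewrite lt_min d0 oppr_gt0.
  rewrite -ltrBlDl lt_min => /andP[xd xi].
  have [x0|/kd] := eqVneq (h x) 0; first by rewrite x0 in xi; lra.
  by rewrite /k; lra.
have [_ [x _ <-]] : exists2 e, range h e & e < i + d by exact: inf_adherent.
have : h x != 0 by rewrite gt_eqF// (le_lt_trans i0)// -subr_gt0; exact: kpos.
by move=> /kd; rewrite /k; lra.
Qed.

(** * The cone of the Hahn-Banach argument and point (ii) *)

(* The cone of functions on which an invariant positive functional has to be
   nonpositive. *)
Definition subcoboundary {R : realType} {G : groupType} (s : seq G) (m : G -> R)
    (A : set G) : set (G -> R) :=
  [set f | exists2 h, carried A h & forall x, f x <= h x - markov s m h x].

Lemma subcoboundary_cone {R : realType} {G : groupType} (s : seq G) (m : G -> R)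
    (A : set G) : convex_cone R (G -> R) (subcoboundary s m A).
Proof.
split.
- exists 0 => [|x]; first exact: carried0.
  by rewrite markov0 subrr.
- move=> f g [h Ah fh] [k Ak gk]; exists (1 *: h + k) => [|x]; first exact: carried_lin.
  rewrite markov_lin !scale1r !fctE; have := fh x; have := gk x; lra.
- move=> c f c0 [h Ah fh]; exists (c *: h) => [|x]; first exact: carried_scale.
  rewrite markov_scale !fctE -scalerBr.
  by rewrite /GRing.scale/= ler_wpM2l.
Qed.

(** Modulo the cone, a translate of [f] costs at most a multiple of [f]. Nonnegative factors [c] are
    needed to chain the bounds along products. *)
Lemma translate_dominated {R : realType} {G : groupType} (s : seq G) (m : G -> R)
    (A : set G) :
  {in s, forall g, 0 < m g} -> gen_semigroup [set` s] = [set: G] ->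
  forall g (f : G -> R), carried A f -> (forall x, 0 <= f x) ->
  exists2 c, 0 <= c & subcoboundary s m A (fun x => f (g * x)%g - c * f x).
Proof.
move=> m0 sT.
apply: (gen_semigroup_ind _ _ sT) => [g /= gs f Af f0|g h IHg IHh f Af f0].
  have mg := m0 _ gs; exists (m g)^-1; first by rewrite invr_ge0 ltW.
  (* From [m g * f (g * x) <= P f x], the difference is at most [(m g)^-1 * (P f x - f x)], a
     coboundary of this witness. *)
  exists (- (m g)^-1 *: f) => [|x]; first exact: carried_scale.
  have := markov_ge _ _ _ _ x m0 f0 gs.
  rewrite markov_scale !fctE /GRing.scale/= mulrC -ler_pdivlMr// mulrC.
  by move: (_^-1) => r; lra.
have [c c0 [k Ak fk]] := IHg _ Af f0.
have [d d0 [l Al fl]] := IHh _ (carried_translate A g f Af) (fun x => f0 _).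
exists (d * c) => [|]; first exact: mulr_ge0.
exists (d *: k + l) => [|x]; first exact: carried_lin.
rewrite markov_lin !fctE -mulgA; have := fl x.
have := ler_wpM2l d0 (fk x); rewrite /GRing.scale/= !mulrBr mulrA; lra.
Qed.

(** Here [f] is at most [C] times the sum of the translates of [\1_A] along [t], and each translate
    is dominated by a multiple of [\1_A]. *)
Lemma carried_dominated {R : realType} {G : groupType} (s : seq G) (m : G -> R)
    (A : set G) (f : G -> R) :
  {in s, forall g, 0 < m g} -> gen_semigroup [set` s] = [set: G] ->
  carried A f -> exists c : R, subcoboundary s m A (f - c *: (\1_A : G -> R)).
Proof.
move=> m0 sT [t [C fC]].
have [_ KD KZ] := subcoboundary_cone s m A.
have [c [h Ah th]] : exists c : R, subcoboundary s m A
    ((fun x => \sum_(g <- t) \1_A (g * x)%g) - c *: (\1_A : G -> R)).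
  elim: t {fC} => [|g t [c IHt]].
    exists 0, 0 => [|x]; first exact: carried0.
    rewrite markov0 subrr.
    by rewrite scale0r subr0 big_nil.
  have [d _ gd] := translate_dominated s m A m0 sT g \1_A
    (carried_indic A A (fun _ => id)) (fun x => ler0n _ _).
  exists (d + c); have := KD _ _ gd IHt.
  congr (subcoboundary s m A _); apply/funext => x.
  by rewrite !fctE big_cons scalerDl opprD addrACA.
exists (C * c), (C *: h) => [|x]; first exact: carried_scale.
have C0 : 0 <= C by rewrite (le_trans (normr_ge0 (f 1%g)))//; case: (fC 1%g).
have := ler_wpM2l C0 (th x); rewrite markov_scale !fctE /GRing.scale/= !mulrBr mulrA.
apply: le_trans; rewrite lerD2r; have [fx ft] := fC x.
have S0 r : 0 <= \sum_(g <- r) \1_A (g * x)%g :> R by rewrite sumr_ge0.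
have [->|/ft[g gt Ag]] := eqVneq (f x) 0; first by rewrite mulr_ge0.
rewrite (le_trans (ler_norm _))// (le_trans fx)// ler_peMr//.
by rewrite (big_rem g)//= indicE mem_set// lerDl.
Qed.

(** * Countability of the group and mass of the support *)

Lemma gen_semigroup_enum {G : groupType} (s : seq G) :
  gen_semigroup [set` s] = [set: G] ->
  exists e : nat -> G, forall g, exists n, e n = g.
Proof.
move=> sT.
(* Words are lists of indices into [s], so that [pickle] can code them; invalid codes stand for the
   identity. *)
pose f (l : seq nat) : G := foldr (fun i x => nth 1 s i * x)%g 1%g l.
have fD l l' : f (l ++ l') = (f l * f l')%g.
  by elim: l => [|i l IH] /=; rewrite ?mul1g// IH mulgA.
pose e n := if unpickle n is Some l then f l else 1%g.
have eE l : e (pickle l) = f l by rewrite /e pickleK.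
exists e.
apply: (gen_semigroup_ind _ _ sT) => [g /= gs|g h [n <-] [n' <-]].
  by exists (pickle [:: index g s]); rewrite eE /= nth_index// mulg1.
rewrite /e; case: (unpickle n) => [l|]; last by rewrite mul1g; exists n'.
case: (unpickle n') => [l'|]; last by exists (pickle l); rewrite mulg1 -eE.
by exists (pickle (l ++ l')); rewrite -fD -eE.
Qed.

(** By countability, the complement of the set of atoms is a countable union of null sets. *)
Lemma msupport_mass {R : realType} {G : groupType} (mu : probability (discrete G) R)
    (s : seq G) :
  uniq s -> msupport mu = [set` s] -> gen_semigroup [set` s] = [set: G] ->
  \sum_(g <- s) fine (mu [set g]) = 1.
Proof.
move=> us muS sT; have [e eT] := gen_semigroup_enum s sT.
have muC0 : mu (~` msupport mu) = 0%E.
  apply: (@measure_negligible _ _ _ mu) => //.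
  apply: (@negligibleS _ _ _ mu (\bigcup_n ([set e n] `&` ~` msupport mu))).
    by move=> g gS; have [n en] := eT g; exists n.
  apply: negligible_bigcup => n; apply/negligibleP => //.
  have [eS|eS] := pselect (msupport mu (e n)).
    rewrite (_ : _ `&` _ = set0) ?measure0//.
    by rewrite -subset0 => g [/= ->].
  rewrite (_ : _ `&` _ = [set e n]).
    by apply/eqP/negPn/negP => H; exact: eS.
  by apply/seteqP; split => [g []//|g /= ->].
have muS1 : mu (msupport mu) = 1%E.
  have := @probability_setT _ _ _ mu.
  rewrite -(setUv (msupport mu)) measureU ?setICr//.
  by rewrite [X in (_ + X)%E]muC0 adde0.
apply/EFin_inj; rewrite -muS1 -sumEFin muS.
have -> : [set` s] = \bigcup_(g in [set` s]) [set g].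
  by apply/seteqP; split => [g gs|g [h hs ->]//]; exists g.
rewrite (@measure_fin_bigcup _ _ _ mu)//; last 2 first.
- exact: finite_seq.
- by move=> g h _ _ [x [-> ->]].
rewrite -fsbig_seq//; apply: eq_bigr => g _; rewrite fineK//.
exact: fin_num_measure.
Qed.

(** * Indicators, translates and the stationary functional *)

Lemma carried_le {R : realType} {G : groupType} (A : set G) (f g : G -> R) :
  (forall x, 0 <= g x <= f x) -> carried A f -> carried A g.
Proof.
move=> gf [t [C fC]]; exists t, C => x.
have /andP[g0 gfx] := gf x; have [fx ft] := fC x; split.
  by rewrite ger0_norm// (le_trans gfx)// (le_trans (ler_norm _)).
move=> gx; apply: ft; rewrite gt_eqF// (lt_le_trans _ gfx)//.
by rewrite lt_def gx.
Qed.

Lemma indic_translate {R : realType} {G : groupType} (E : set G) (g : G) :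
  \1_[set (g^-1 * x)%g | x in E] = (fun x => \1_E (g * x)%g) :> (G -> R).
Proof.
apply/funext => x; rewrite !indicE; congr (_%:R); congr (nat_of_bool _).
apply/idP/idP; rewrite !inE; first by case=> y Ey <-; rewrite mulVKg.
by move=> Ex; exists (g * x)%g => //; rewrite mulKg.
Qed.

Lemma carried_translateE {R : realType} {G : groupType} (A : set G) (g : G)
    (f : G -> R) :
  carried A (fun x => f (g * x)%g) <-> carried A f.
Proof.
split; last exact: carried_translate.
move=> /(carried_translate A g^-1%g); congr (carried A _).
by apply/funext => x /=; rewrite mulVKg.
Qed.

(** The cone contains [- f] for [f >= 0] (take [h = 0]), which gives positivity, and [h - P h] for
    every [h] in [L], which gives stationarity. *)
Lemma ex_stationary_functional {R : realType} {G : groupType} (s : seq G) (m : G -> R)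
    (A : set G) :
  {in s, forall g, 0 < m g} -> \sum_(g <- s) m g = 1 ->
  gen_semigroup [set` s] = [set: G] -> A !=set0 ->
  exists M : (G -> R) -> R,
    [/\ forall a f g, carried A f -> carried A g -> M (a *: f + g) = a * M f + M g,
        forall f, carried A f -> (forall x, 0 <= f x) -> 0 <= M f,
        forall f, carried A f ->
          M f = \sum_(g <- s) m g * M (fun x => f (g * x)%g) & M \1_A = 1].
Proof.
move=> m0 m1 sT A0.
have Au : carried A (\1_A : G -> R) by exact: carried_indic.
have [||||||M [Mlin Mle0 M1]] := ex_cone_functional R (G -> R)
  (subcoboundary s m A) (carried A) \1_A (subcoboundary_cone s m A) => //.
- exists 0 => [|x]; first exact: carried0.
  by rewrite markov0 subrr oppr_le0.
- by move=> [h Ah]; exact: carried_potential_false m0 m1 sT A0 Ah.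
- exact: carried0.
- by move=> a f g; exact: carried_lin.
- by move=> f; exact: carried_dominated.
have M0 : M 0 = 0.
  have /eqP := Mlin 1 0 0 (carried0 A) (carried0 A).
  by rewrite scale1r addr0 mul1r eq_sym -subr_eq0 addrK => /eqP.
have MZ a f : carried A f -> M (a *: f) = a * M f.
  by move=> Af; have := Mlin a f 0 Af (carried0 A); rewrite !addr0 M0 addr0.
have Mmarkov r f : carried A f ->
    M (markov r m f) = \sum_(g <- r) m g * M (fun x => f (g * x)%g).
  move=> Af; elim: r => [|g r IH].
    by rewrite big_nil -[RHS]M0; congr M; apply/funext => x; rewrite /markov big_nil.
  have -> : markov (g :: r) m f = m g *: (fun x => f (g * x)%g) + markov r m f.
    by apply/funext => x; rewrite /markov big_cons.
  rewrite Mlin; [|exact: carried_translate|exact: carried_markov].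
  by rewrite IH big_cons.
exists M; split => // f Af.
- move=> f0; rewrite -oppr_le0 -mulN1r -MZ//.
  apply: Mle0; first exact: carried_scale.
  exists 0 => [|x]; first exact: carried0.
  by rewrite markov0 subrr scaleN1r oppr_le0.
- rewrite -Mmarkov//.
  (* Applied to [f] and to [- f], this one-sided bound becomes an equality. *)
  have H h : carried A h -> M h <= M (markov s m h).
    move=> Ah; have Ph := carried_markov A s m h Ah.
    rewrite -subr_le0 addrC -mulN1r -Mlin//; apply: Mle0; first exact: carried_lin.
    by exists h => // x; rewrite scaleN1r addrC.
  apply/eqP; rewrite eq_le H//=.
  have := H _ (carried_scale A (-1) f Af).
  rewrite markov_scale !MZ//; last exact: carried_markov.
  by rewrite !mulN1r lerN2.
Qed.

(** * From the functional to a finitely additive measure *)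

Theorem theorem2 (R : realType) (G : groupType)
    (mu : probability (discrete G) R) (A : set G) :
  finitely_generated G ->
  finitely_supported mu ->
  nondegenerate_measure mu ->
  A !=set0 ->
  exists M : set G -> \bar R,
    [/\ finitely_additive_measure M, stationary mu M & M A = 1%E].
Proof.
move=> _ /finite_seqP[s0 muS0] nd A0.
pose s := undup s0.
have us : uniq s by exact: undup_uniq.
have muS : msupport mu = [set` s].
  by rewrite muS0; apply/seteqP; split => g /=; rewrite mem_undup.
have sT : gen_semigroup [set` s] = [set: G] by rewrite -muS.
pose m (g : G) := fine (mu [set g]).
have muE g : mu [set g] = (m g)%:E by rewrite fineK//; exact: fin_num_measure.
have m0 : {in s, forall g, 0 < m g}.
  move=> g gs; have : msupport mu g by rewrite muS.
  by rewrite /msupport /= muE eqe lt_def => ->; rewrite fine_ge0.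
have [M [Mlin M_ge0 Mstat MA]] := ex_stationary_functional s m A m0
  (msupport_mass mu s us muS sT) sT A0.
(* Sets not covered by finitely many translates of [A] get infinite measure. *)
pose N (E : set G) : \bar R :=
  if `[< carried A (\1_E : G -> R) >] then (M \1_E)%:E else +oo%E.
have Nfin E : carried A (\1_E : G -> R) -> N E = (M \1_E)%:E.
  by move=> AE; rewrite /N asboolT.
have Noo E : ~ carried A (\1_E : G -> R) -> N E = +oo%E.
  by move=> AE; rewrite /N asboolF.
have N0 E : (0 <= N E)%E.
  have [AE|AE] := pselect (carried A (\1_E : G -> R)); last by rewrite Noo.
  by rewrite Nfin// lee_fin M_ge0.
have indic01 (E : set G) x : 0 <= \1_E x :> R by rewrite indicE.
exists N; split.
- split=> // B C BC0.
  have BCE : \1_(B `|` C) = 1 *: (\1_B : G -> R) + (\1_C : G -> R).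
    apply/funext => x; rewrite scale1r !fctE !indicE in_setU.
    case: (boolP (x \in B)) => xB; case: (boolP (x \in C)) => xC;
      rewrite /= ?addr0 ?add0r//.
    by move: xB xC; rewrite !inE => xB xC; have : (B `&` C) x by []; rewrite BC0.
  (* If one of [B], [C] has infinite measure, so does the union by [carried_le], and both sides are
     [+oo]. *)
  have [AB|AB] := pselect (carried A (\1_B : G -> R)); last first.
    rewrite (Noo B)// addye ?gt_eqF ?(lt_le_trans _ (N0 _))// ?Noo//.
    apply: contra_not AB; apply: carried_le => x.
    by rewrite BCE scale1r indic01 fctE lerDl indic01.
  have [AC|AC] := pselect (carried A (\1_C : G -> R)); last first.
    rewrite (Noo C)// addey ?gt_eqF ?(lt_le_trans _ (N0 _))// ?Noo//.
    apply: contra_not AC; apply: carried_le => x.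
    by rewrite BCE scale1r indic01 fctE lerDr indic01.
  have ABC : carried A (\1_(B `|` C) : G -> R) by rewrite BCE; exact: carried_lin.
  by rewrite !Nfin// BCE Mlin// mul1r EFinD.
- apply/funext => E; rewrite /convolution muS -fsbig_seq//.
  have [AE|AE] := pselect (carried A (\1_E : G -> R)).
    rewrite Nfin// Mstat// -sumEFin; apply: eq_bigr => g _.
    rewrite /left_translate Nfin indic_translate; last exact: carried_translate.
    by rewrite muE EFinM.
  rewrite Noo//.
  (* All terms are now [+oo] with positive weights; the sum must be nonempty, as an empty one would
     be 0. *)
  have s_gt0 : (0 < size s)%N.
    rewrite lt0n; apply/eqP => /size0nil s0E.
    by have := msupport_mass mu s us muS sT; rewrite s0E big_nil => /eqP; rewrite eq_sym oner_eq0.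
  have trE g : left_translate g N E = +oo%E.
    by rewrite /left_translate Noo// indic_translate carried_translateE.
  case: (s) m0 s_gt0 => // g r m0 _.
  rewrite big_cons trE muE gt0_muley ?lte_fin ?m0 ?mem_head//; apply: addye.
  rewrite gt_eqF// (lt_le_trans ltNy0)// sume_ge0// => h _.
  by rewrite mule_ge0// trE leey.
- by rewrite Nfin ?MA//; exact: carried_indic.
Qed.
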